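(* Let $T=(T_1,\dots,T_n)$ be an $n$-tuple of near-isometries on a Hilbert space $\mathcal H$ that admits a Wold-type decomposition. Then this decomposition is unique: if $\mathcal H=\bigoplus_{A\subseteq I_n}\mathcal H_A$ is a Wold-type decomposition for $T$, then for every $A\subseteq I_n$, $$\mathcal H_A=\Big(\bigcap_{i\in I_n\setminus A}\mathcal H_{T_i,I}\Big)\cap\Big(\bigcap_{k\in A}\mathcal H_{T_k,S}\Big).$$
   Context: All Hilbert spaces are complex and separable; $I_n=\{1,\dots,n\}$; an intersection over the empty index set is $\mathcal H$. An operator $T\in B(\mathcal H)$ is a near-isometry if (i) there is $\delta>0$ with $\delta\|x\|\le\|Tx\|\le\|x\|$ for all $x\in\mathcal H$, and (ii) $T^{*n}T^{n+1}\mathcal H\subseteq T\mathcal H$ for each $n\ge 0$. $T$ is a shift operator on $\mathcal H$ if there is a closed subspace $\mathcal W\subseteq\mathcal H$ with $T^i\mathcal W\perp T^j\mathcal W$ for all non-negative integers $i\neq j$ and $\mathcal H=\bigoplus_{n=0}^\infty T^n\mathcal W$. For a near-isometry $T$ on $\mathcal H$ put $\mathcal H_{T,S}=\bigoplus_{n\ge0}T^n(\ker T^* )$ and $\mathcal H_{T,I}=\bigcap_{n\ge0}T^n\mathcal H$. (Known Wold-type decomposition for a near-isometry: $\mathcal H=\mathcal H_{T,S}\oplus\mathcal H_{T,I}$, both subspaces reduce $T$, $T|_{\mathcal H_{T,S}}$ is a shift operator and $T|_{\mathcal H_{T,I}}$ is invertible.) An $n$-tuple $(T_1,\dots,T_n)$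 of near-isometries on $\mathcal H$ admits a Wold-type decomposition if there exist $2^n$ closed subspaces $\{\mathcal H_A\}_{A\subseteq I_n}$ of $\mathcal H$ (possibly zero), each reducing every $T_i$, such that $\mathcal H=\bigoplus_{A\subseteq I_n}\mathcal H_A$ (orthogonal direct sum), $T_i|_{\mathcal H_A}$ is a shift operator if $i\in A$, and $T_i|_{\mathcal H_A}$ is an invertible operator if $i\in I_n\setminus A$; such a family is called a Wold-type decomposition for the tuple. *)

(* Defs.v *)
From HB Require Import structures.
From mathcomp Require Import all_boot all_order all_algebra.
From mathcomp Require Import complex.
From mathcomp Require Import all_classical all_reals.
From mathcomp Require Import topology normedtype sequences.

Set Implicit Arguments.
Unset Strict Implicit.
Unset Printing Implicit Defensive.

Import Order.TTheory GRing.Theory Num.Theory.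
Import numFieldNormedType.Exports.
Local Open Scope classical_set_scope.
Local Open Scope complex_scope.
Local Open Scope ring_scope.

(* Norms of a normed module over R[i] take their values in R[i]; [inner] is
   linear on the left and conjugate-linear on the right. *)
HB.mixin Record CompleteNormedModule_isHilbert (R : realType) H
    & CompleteNormedModule R[i] H := {
  inner : {dot H for @Num.conj R[i]};
  inner_norm : forall x : H, inner x x = `|x| ^+ 2
}.

#[short(type="hilbertType")]
HB.structure Definition Hilbert (R : realType) :=
  {H of CompleteNormedModule_isHilbert R H & CompleteNormedModule R[i] H}.

Definition separable (X : topologicalType) :=
  exists2 D : set X, countable D & dense D.

Section Hilbert.
Context {R : realType} {H : hilbertType R}.
Implicit Types (K L W : set H) (T : {linear H -> H}).

Definition perp K L :=
  forall x y, K x -> L y -> inner x y = 0.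

Definition ortho_compl K : set H :=
  [set y | forall x, K x -> inner x y = 0].

Definition closed_subspace K := closed K /\ submod_closed (fun x => x \in K).

(* T^*: for a continuous T, the Riesz representation theorem gives exactly
   one z with the required property, so the default value 0 is never used. *)
Definition adjoint T (y : H) : H :=
  xget 0 [set z | forall x, inner (T x) y = inner x z].

(* The sums of the convergent series with k-th term in M k.  If the M k are
   pairwise orthogonal closed subspaces, this is their Hilbert space direct
   sum; orthogonality is required separately where needed. *)
Definition hilbert_sum (M : nat -> set H) : set H :=
  [set x | exists2 u : nat -> H,
     (forall k, M k (u k)) & series u @ \oo --> x].

Definition near_isometry T :=
  [/\ continuous T,
      exists2 delta : R, 0 < delta &
        forall x, delta%:C * `|x| <= `|T x| <= `|x|
    & forall n : nat,
        [set iter n (adjoint T) (iter n.+1 T x) | x in setT] `<=` range T].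

Definition reduces K T :=
  T @` K `<=` K /\ T @` ortho_compl K `<=` ortho_compl K.

(* The next two predicates speak of the restriction of T to a closed
   subspace K that reduces T, regarded as an operator on the Hilbert space K;
   K = setT gives the notions for T itself. *)
Definition shift_on K T :=
  exists W, [/\ closed_subspace W, W `<=` K,
    forall i j : nat, i <> j -> perp (iter i T @` W) (iter j T @` W)
    & K = hilbert_sum (fun k => iter k T @` W)].

(* The inverse S, given as a total function, is only relevant on K. *)
Definition invertible_on K T :=
  exists S : H -> H, [/\ S @` K `<=` K, {within K, continuous S},
    forall x, K x -> S (T x) = x & forall x, K x -> T (S x) = x].

Definition shift_part T : set H :=
  hilbert_sum (fun k => iter k T @` [set y | adjoint T y = 0]).

Definition invertible_part T : set H :=
  \bigcap_(k : nat) range (iter k T).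

Definition wold_decomposition (n : nat) (T : 'I_n -> {linear H -> H})
    (HA : {set 'I_n} -> set H) :=
  [/\ forall A : {set 'I_n}, closed_subspace (HA A),
      forall (A : {set 'I_n}) i, reduces (HA A) (T i),
      forall A B : {set 'I_n}, A <> B -> perp (HA A) (HA B),
      forall x, exists2 u : {set 'I_n} -> H,
        (forall A : {set 'I_n}, HA A (u A)) & x = \sum_A u A
    & forall (A : {set 'I_n}) i,
        if i \in A then shift_on (HA A) (T i)
        else invertible_on (HA A) (T i)].

Definition admits_wold_decomposition (n : nat) (T : 'I_n -> {linear H -> H}) :=
  exists HA, wold_decomposition T HA.

End Hilbert.

(* Main.v *)
Require Import Defs.
From mathcomp Require Import all_boot all_order all_algebra.
From mathcomp Require Import all_classical all_reals.
From mathcomp Require Import topology normedtype sequences.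
From mathcomp Require Import complex interval_inference ring lra.

(* For a near-isometry, the condition [T^*n T^(n+1) H <= T H] makes
   [T^n (ker T^* )] orthogonal to [T^(n+1) H], so the shift part of [T] is
   orthogonal to its invertible part.  In a Wold-type decomposition, [HA A] lies
   in the shift part of [T i] when [i \in A] and in the invertible part
   otherwise.  Conversely, if [x] lies in the intersection attached to [A] and
   [B <> A], an index in exactly one of [A] and [B] puts [x] and the component
   of [x] in [HA B] into orthogonal parts, so that component is zero. *)

Set Implicit Arguments.
Unset Strict Implicit.
Unset Printing Implicit Defensive.

Import Order.TTheory GRing.Theory Num.Theory.
Import numFieldNormedType.Exports.
Local Open Scope classical_set_scope.
Local Open Scope complex_scope.
Local Open Scope ring_scope.

(** * Real part of the inner product, and Riesz representation *)

Section RealInner.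
Context {R : realType} {H : hilbertType R}.
Implicit Types (x y z v : H) (a b : R[i]) (t : R).

(** Squares and infima are compared in the ordered field [R]; complex identities are recovered by
    also testing against ['i%C] multiples. *)
Definition reinner x y : R := complex.Re (inner x y).
Definition normsq x : R := reinner x x.

Lemma innerC x y : inner x y = (inner y x)^*.
Proof. by rewrite hermC expr0 mul1r. Qed.

Lemma innerZl a x y : inner (a *: x) y = a * inner x y.
Proof. exact: linearZl_LR. Qed.

Lemma innerZr a x y : inner x (a *: y) = a^* * inner x y.
Proof. exact: linearZr_LR. Qed.

Lemma innerDl x y z : inner (x + y) z = inner x z + inner y z.
Proof. exact: linearDl. Qed.

Lemma ReD a b : complex.Re (a + b) = complex.Re a + complex.Re b.
Proof. by case: a; case: b. Qed.

Lemma ReN a : complex.Re (- a) = - complex.Re a.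
Proof. by case: a. Qed.

Lemma reinnerC x y : reinner x y = reinner y x.
Proof. by rewrite /reinner innerC; case: (inner y x). Qed.

Lemma reinner0l x : reinner 0 x = 0.
Proof. by rewrite /reinner linear0l. Qed.

Lemma reinnerDl x y z : reinner (x + y) z = reinner x z + reinner y z.
Proof. by rewrite /reinner innerDl ReD. Qed.

Lemma reinnerNl x z : reinner (- x) z = - reinner x z.
Proof. by rewrite /reinner linearNl ReN. Qed.

Lemma reinnerZl t x y : reinner (t%:C *: x) y = t * reinner x y.
Proof.
by rewrite /reinner innerZl; case: (inner x y) => u w /=; rewrite mul0r subr0.
Qed.

Lemma reinner_i x y : reinner x ('i%C *: y) = complex.Im (inner x y).
Proof.
rewrite /reinner innerZr; case: (inner x y) => u w /=.
by rewrite mul0r sub0r mulN1r opprK.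
Qed.

Lemma inner_eq_reinner x y w :
  (forall c : R[i], reinner x (c *: y) = reinner w (c *: y)) ->
  inner x y = inner w y.
Proof.
move=> e; have := e 'i%C; rewrite !reinner_i; have := e 1; rewrite !scale1r.
rewrite /reinner; case: (inner x y) => a b; case: (inner w y) => c d /=.
by move=> -> ->.
Qed.

Lemma normsqE x : `|x| ^+ 2 = (normsq x)%:C.
Proof.
rewrite -inner_norm /normsq /reinner RRe_real // inner_norm.
by rewrite realX // normr_real.
Qed.

Lemma normsq_ge0 x : 0 <= normsq x.
Proof. by rewrite -ler0c -normsqE exprn_ge0. Qed.

Lemma normsqD x y : normsq (x + y) = normsq x + normsq y + 2 * reinner x y.
Proof.
rewrite /normsq !reinnerDl !(reinnerC _ (x + y)) !reinnerDl (reinnerC y x).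
by ring.
Qed.

Lemma normsqN x : normsq (- x) = normsq x.
Proof. by rewrite /normsq reinnerNl reinnerC reinnerNl opprK. Qed.

Lemma normsqZ t x : normsq (t%:C *: x) = t ^+ 2 * normsq x.
Proof. by rewrite /normsq reinnerZl reinnerC reinnerZl; ring. Qed.

Lemma inner_self_eq0 x : inner x x = 0 -> x = 0.
Proof.
by rewrite inner_norm => /eqP; rewrite expf_eq0 /= normr_eq0 => /eqP.
Qed.

Lemma reinner_CauchySchwarz x y : reinner x y ^+ 2 <= normsq x * normsq y.
Proof.
have [y0|y0] := eqVneq (normsq y) 0.
  have -> : y = 0 by apply: inner_self_eq0; rewrite inner_norm normsqE y0.
  by rewrite reinnerC reinner0l expr0n mulr_ge0 ?normsq_ge0.
have y_gt0 : 0 < normsq y by rewrite lt0r y0 normsq_ge0.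
(* Expanded, this square norm is [normsq y] times the difference of the two sides. *)
have := normsq_ge0 ((normsq y)%:C *: x + (- reinner x y)%:C *: y).
rewrite normsqD !normsqZ reinnerZl (reinnerC x (_ *: y)) reinnerZl (reinnerC y).
move=> h; rewrite -subr_ge0 -(pmulr_rge0 _ y_gt0); move: h; congr (_ <= _).
by ring.
Qed.

Lemma cvg_normsq (u : H ^nat) z (e : R) : u @ \oo --> z -> 0 < e ->
  \forall n \near \oo, normsq (z - u n) < e.
Proof.
move=> uz e0; have s0 : 0 < (Num.sqrt e)%:C by rewrite ltcR sqrtr_gt0.
apply: filterS (cvgr_dist_lt _ _ uz _ s0) => n lt_zu.
have : `|z - u n| ^+ 2 < (Num.sqrt e)%:C ^+ 2.
  by rewrite ltr_pXn2r // nnegrE // ltW.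
by rewrite normsqE -rmorphXn ltcR sqr_sqrtr // ltW.
Qed.

Lemma inner_cvg0 (u : H ^nat) z y : u @ \oo --> z ->
  (forall n, inner (u n) y = 0) -> inner z y = 0.
Proof.
move=> uz u0; rewrite -(linear0l inner y); apply: inner_eq_reinner => c.
rewrite reinner0l.
set w := c *: y.
have uw n : reinner (u n) w = 0 by rewrite /reinner innerZr u0 mulr0.
apply/eqP; rewrite -sqrf_eq0 eq_le sqr_ge0 andbT.
apply/ler_addgt0Pl => e e0; rewrite addr0.
(* Adding 1 keeps the divisor positive when [w] is zero. *)
have w1 : 0 < normsq w + 1 by rewrite ltr_wpDl ?normsq_ge0.
have [n _ /(_ n (leqnn n)) nP] := cvg_normsq uz (divr_gt0 e0 w1).
have := reinner_CauchySchwarz (z - u n) w.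
rewrite reinnerDl reinnerNl uw subr0 => /le_trans; apply.
move: nP; rewrite /= ltr_pdivlMr // => /ltW; apply: le_trans.
by rewrite ler_wpM2l ?normsq_ge0 // lerDl.
Qed.

(* The representing vector minimises [normsq x - 2 * Re (f x)]; a minimising
   sequence is Cauchy by the parallelogram identity. *)
Lemma riesz_representation (f : H -> R[i]) (M : R) :
  scalar f -> (forall x, complex.Re (f x) ^+ 2 <= M * normsq x) ->
  exists z, forall x, f x = inner x z.
Proof.
move=> flin fM; pose g x := complex.Re (f x).
have g_lin t x y : g (t%:C *: x + y) = t * g x + g y.
  rewrite /g flin; case: (f x) => a b; case: (f y) => c d /=.
  by rewrite mul0r subr0.
have gD x y : g (x + y) = g x + g y.
  by have := g_lin 1 x y; rewrite scale1r mul1r.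
have f0 : f 0 = 0 by have := flin (-1) 0 0; rewrite scaler0 addr0 mulN1r addNr.
pose J x := normsq x - 2 * g x.
have J_lb : exists b : R, forall x, b <= J x.
  pose N := `|M| + 1; have N0 : 0 < N by rewrite ltr_wpDl.
  exists (- N) => x; rewrite /J.
  have : g x ^+ 2 <= N * normsq x.
    apply: le_trans (fM x) _; rewrite ler_wpM2r ?normsq_ge0 //.
    by rewrite (le_trans (ler_norm _)) // lerDl.
  (* After multiplication by [N], the bound follows from [(g x - N)^2 >= 0]. *)
  move=> gN; rewrite -(ler_pM2l N0) -subr_ge0.
  have := sqr_ge0 (g x - N); nra.
pose E := range J; pose m := inf E.
have E_inf : has_inf E.
  split; first by exists (J 0), 0.
  by case: J_lb => b bP; exists b => _ [x _ <-].
have m_le x : m <= J x by apply: ge_inf; [exact: E_inf.2 | exists x].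
have ex_u (n : nat) : exists x, J x < m + n.+1%:R^-1.
  have [_ [x _ <-] xP] : exists2 e, E e & e < m + n.+1%:R^-1.
    by apply: inf_adherent => //; rewrite invr_gt0 ltr0n.
  by exists x.
have [u uP] := choice ex_u.
have u_dist n k : normsq (u n - u k) <= 2 * (n.+1%:R^-1 + k.+1%:R^-1).
  (* The left side equals [2 J(u n) + 2 J(u k) - 4 J(p)] with [p] the midpoint, and [J(p) >= m]. *)
  have := m_le ((2^-1)%:C *: (u n + u k)).
  have := normsqD (u n) (- u k); rewrite normsqN reinnerC reinnerNl.
  rewrite (reinnerC (u k)) => ->.
  rewrite /J normsqZ normsqD -[(2^-1)%:C *: _]addr0 g_lin gD.
  have -> : g 0 = 0 by rewrite /g f0.
  have := uP n; have := uP k; rewrite /J.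
  by move: (n.+1%:R^-1) (k.+1%:R^-1) => ? ?; lra.
have near_inv (e : R) : 0 < e -> \forall n \near \oo, (n.+1%:R^-1 : R) < e.
  by move=> e0; exact: near_infty_natSinv_lt (PosNum e0).
have /cauchy_cvg ucvg : cauchy (u @ \oo).
  apply: cauchy_exP => e e0.
  (* Radii of balls lie in [R[i]]; a positive one is real. *)
  have [e' ee'] : exists e', e = e'%:C by exact/complex_realP/gtr0_real.
  move: e0; rewrite {}ee' ltcR => e0.
  have e4 : 0 < e' ^+ 2 / 4 by rewrite divr_gt0 ?exprn_gt0.
  have [N _ NP] := near_inv _ e4.
  exists (u N); exists N => // n /= Nn; rewrite -ball_normE /ball_ /=.
  rewrite -(ltr_pXn2r (n := 2)) ?nnegrE ?lecR ?(ltW e0) //.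
  rewrite normsqE -rmorphXn /= ltcR (le_lt_trans (u_dist _ _)) //.
  have := NP N (leqnn N); have := NP n Nn; rewrite /=.
  by move: (n.+1%:R^-1) (N.+1%:R^-1) => ? ?; lra.
have [z uz] : exists z, u @ \oo --> z by exists (lim (u @ \oo)).
exists z => x.
have gE v : g v = reinner v z.
  apply/eqP; rewrite -subr_eq0 -sqrf_eq0 eq_le sqr_ge0 andbT.
  apply/ler_addgt0Pl => e e0; rewrite addr0.
  set Q := normsq v + 1; have Q0 : 0 < Q by rewrite ltr_wpDl ?normsq_ge0.
  (* The error is a sum of two terms whose squares are each below [Q * (e / (4 * Q)) = e / 4], so
     its square is below [e]. *)
  have eQ : 0 < e / (4 * Q) by rewrite divr_gt0 // mulr_gt0.
  have [n [n1 n2]] : exists n, n.+1%:R^-1 < e / (4 * Q)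
      /\ normsq (z - u n) < e / (4 * Q).
    have [n _ nP] := filterI (near_inv _ eQ) (cvg_normsq uz eQ).
    by exists n; exact: nP (leqnn n).
  pose d := reinner v (u n) - g v.
  have d_le : d ^+ 2 <= Q * n.+1%:R^-1.
    (* Moving from [u n] by [- s v] changes [J] by [s^2 * normsq v - 2 s d = - s^2 (Q + 1)], which
       cannot bring it below [m]. *)
    pose s := d / Q; have dE : d = s * Q by rewrite divfK // gt_eqF.
    have := m_le ((- s)%:C *: v + u n); have := uP n.
    rewrite /J normsqD normsqZ reinnerZl g_lin sqrrN.
    have -> : normsq v = Q - 1 by rewrite addrK.
    have -> : reinner v (u n) = s * Q + g v by rewrite -dE subrK.
    move=> h1 h2; rewrite dE exprMn (expr2 Q) mulrA mulrC ler_wpM2l ?ltW //.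
    move: h1 h2 (sqr_ge0 s); move: (n.+1%:R^-1) => i; lra.
  have c_le : reinner (z - u n) v ^+ 2 <= Q * normsq (z - u n).
    apply: le_trans (reinner_CauchySchwarz _ _) _.
    by rewrite mulrC ler_wpM2r ?normsq_ge0 // lerDl.
  have -> : (g v - reinner v z) ^+ 2 = (d + reinner (z - u n) v) ^+ 2.
    by rewrite /d reinnerDl reinnerNl (reinnerC z) (reinnerC (u n)); ring.
  move: n1 n2; rewrite !ltr_pdivlMr ?mulr_gt0 // => n1 n2.
  move: d_le c_le n1 n2 (sqr_ge0 (d - reinner (z - u n) v)).
  by move: (n.+1%:R^-1) (normsq _) (reinner _ _) => i nz r; lra.
(* The values at [x] and at [i x] give the real and imaginary parts. *)
have gi := gE ('i%C *: x); have gx := gE x.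
move: gi; rewrite /g /reinner innerZl.
rewrite -[_ *: x]addr0 flin f0.
move: gx; rewrite /g /reinner addr0.
case: (f x) => a b; case: (inner x z) => c e /= -> /eqP.
by rewrite !mul0r !sub0r !mul1r eqr_opp => /eqP ->.
Qed.

End RealInner.

(** * Adjoints, shift and invertible parts, Wold-type decompositions *)

Section NearIsometry.
Context {R : realType} {H : hilbertType R}.
Implicit Types (K L : set H) (M : nat -> set H) (T : {linear H -> H}).

Lemma perp_sym K L : perp K L -> perp L K.
Proof. by move=> KL x y Lx Ky; rewrite innerC (KL y x) // conjC0. Qed.

Lemma near_isometry_normsq_le T x : near_isometry T ->
  normsq (T x) <= normsq x.
Proof.
move=> [_ [d _ /(_ x) /andP[_ Tx]] _].
by rewrite -lecR -!normsqE lerXn2r // nnegrE.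
Qed.

Lemma inner_adjoint T x y : near_isometry T ->
  inner (T x) y = inner x (adjoint T y).
Proof.
move=> nT; pose f x := inner (T x) y.
have [||z zP] := @riesz_representation R H f (normsq y).
- by move=> a u v; rewrite /f (linearP T) innerDl innerZl.
- move=> u; apply: le_trans (reinner_CauchySchwarz (T u) y) _.
  by rewrite mulrC ler_wpM2l ?normsq_ge0 ?near_isometry_normsq_le.
(* The Riesz vector [z] rules out the default value of [xget]. *)
by rewrite /adjoint; case: xgetP => [_ -> // | /(_ z)]; case.
Qed.

Lemma inner_iter_adjoint T k x y : near_isometry T ->
  inner (iter k T x) y = inner x (iter k (adjoint T) y).
Proof.
move=> nT; elim: k x y => [//|k IHk] x y.
by rewrite iterS inner_adjoint // IHk -iterSr.
Qed.

(** Either the default 0 is taken, or the chosen [z] satisfies [<z, z> = <T z, y> = 0]. *)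
Lemma adjoint_eq0 T y : (forall x, inner (T x) y = 0) -> adjoint T y = 0.
Proof.
move=> y0; rewrite /adjoint; case: xgetP => [z _ zP|//].
by apply: inner_self_eq0; rewrite -zP.
Qed.

Lemma hilbert_sumS M N : (forall k, M k `<=` N k) ->
  hilbert_sum M `<=` hilbert_sum N.
Proof. by move=> MN x [u uM ux]; exists u => // k; exact/MN/uM. Qed.

Lemma perp_hilbert_sum M L : (forall k, perp (M k) L) ->
  perp (hilbert_sum M) L.
Proof.
move=> ML x y [u uM ux] Ly; apply: inner_cvg0 ux _ => n.
by rewrite linear_sumlz big1 // => k _; exact: ML.
Qed.

Lemma perp_shift_part_invertible_part T : near_isometry T ->
  perp (shift_part T) (invertible_part T).
Proof.
(* Against [T^k w], the vector [y] is written as [T^(k+1) v], one power more: then [T^*k y] lies in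
   the range of [T], which is orthogonal to [w]. *)
move=> nT; apply: perp_hilbert_sum => k _ y [w w0 <-] /(_ k.+1 I)[v _ <-].
rewrite inner_iter_adjoint //; have [_ _ /(_ k)] := nT.
move=> /(_ _ (imageP _ (I : setT v)))[v' _ <-].
by rewrite innerC inner_adjoint // w0 linear0r conjC0.
Qed.

(* The wandering subspace lies in the kernel of the adjoint: writing [x = a + b]
   along [K], [T b] is orthogonal to [K] and [T a] is a sum of vectors of
   [T^(k+1) W], so [T x] is orthogonal to [W]. *)
Lemma shift_on_sub_shift_part K T : continuous T -> reduces K T ->
  (forall x, exists2 a, K a & ortho_compl K (x - a)) ->
  shift_on K T -> K `<=` shift_part T.
Proof.
move=> contT [_ redT] decK [W [_ WK orthW KE]].
suff Wker : W `<=` [set y | adjoint T y = 0].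
  by rewrite KE; apply: hilbert_sumS => k; exact: image_subset.
move=> w Ww; apply: adjoint_eq0 => x; have [a Ka axK] := decK x.
rewrite -(subrK a x) (linearD T) innerDl innerC.
rewrite (redT _ (imageP _ axK)) ?conjC0 ?add0r; last exact: WK.
move: Ka; rewrite KE => -[u uW ua].
have Tua : (fun n => T (series u n) : H) @ \oo --> (T a : H).
  exact: continuous_cvg (contT a) ua.
apply: inner_cvg0 Tua _ => n.
rewrite linear_sum linear_sumlz big1 // => k _; have [w' Ww' <-] := uW k.
by apply: (orthW k.+1 0%N) => //; [exists w' | exists w].
Qed.

Lemma invertible_on_sub_invertible_part K T : invertible_on K T ->
  K `<=` invertible_part T.
Proof.
move=> [S [SK _ _ TS]] x Kx k _.
(* The preimage is kept in [K], where [S] inverts [T]. *)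
suff [v Kv <-] : exists2 v, K v & iter k T v = x by exists v.
elim: k => [|k [v Kv <-]]; first by exists x.
by exists (S v); [exact/SK/imageP | rewrite iterSr TS].
Qed.

(** The component of [x] in [HA A] is its orthogonal projection, because the other components are
    orthogonal to [HA A]. *)
Lemma wold_decomposition_ortho_compl n (T : 'I_n -> {linear H -> H}) HA
    (A : {set 'I_n}) x : wold_decomposition T HA ->
  exists2 a, HA A a & ortho_compl (HA A) (x - a).
Proof.
move=> [_ _ perpHA sumHA _]; have [u uHA ->] := sumHA x.
exists (u A) => // y Ay; rewrite (bigD1 A) //= addrC addrK.
rewrite linear_sumr big1 // => B /eqP BA.
by apply: perpHA Ay (uHA B) => /esym.
Qed.

Lemma wold_decomposition_sub n (T : 'I_n -> {linear H -> H}) HA A i :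
  (forall i, near_isometry (T i)) -> wold_decomposition T HA ->
  HA A `<=` if i \in A then shift_part (T i) else invertible_part (T i).
Proof.
move=> nT wT; have [_ redHA _ _ /(_ A i)] := wT.
case: ifP => iA; last exact: invertible_on_sub_invertible_part.
apply: shift_on_sub_shift_part; [by have [] := nT i | exact: redHA|].
by move=> x; exact: wold_decomposition_ortho_compl wT.
Qed.

Lemma wold_decompositionE n (T : 'I_n -> {linear H -> H}) HA A :
  (forall i, near_isometry (T i)) -> wold_decomposition T HA ->
  HA A = (\bigcap_(i in [set i | i \notin A]) invertible_part (T i)) `&`
         (\bigcap_(k in [set k | k \in A]) shift_part (T k)).
Proof.
move=> nT wT; apply/seteqP; split=> [x Ax|x [xI xS]].
  by split=> i /= iA; have := wold_decomposition_sub i nT wT Ax;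
    rewrite ?(negbTE iA) ?iA.
have [_ _ perpHA sumHA _] := wT; have [u uHA xE] := sumHA x.
suff u0 B : B != A -> u B = 0.
  by rewrite xE (bigD1 A) //= big1 ?addr0.
move=> BA; apply: inner_self_eq0.
(* Pairing [x] with [u B] kills every other component. *)
have -> : inner (u B) (u B) = inner x (u B).
  rewrite xE linear_sumlz (bigD1 B) //= big1 ?addr0 // => C /eqP CB.
  exact: perpHA (uHA C) (uHA B).
have [i iAB] : exists i, (i \in B) != (i \in A).
  apply/existsP; apply: contraNT BA => /existsPn AB.
  by apply/eqP/setP => i; have := AB i; rewrite negbK => /eqP.
have perpT := perp_shift_part_invertible_part (nT i).
have := wold_decomposition_sub i nT wT (uHA B).
move: iAB; case: ifP => iB; case: (boolP (i \in A)) => iA // _ uB.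
  by apply: perp_sym perpT _ _ _ uB; exact: xI.
by apply: perpT uB; exact: xS.
Qed.

End NearIsometry.

Theorem mainTheorem3 (R : realType) (H : hilbertType R) (sepH : separable H)
    (n : nat) (T : 'I_n -> {linear H -> H})
    (nearT : forall i, near_isometry (T i))
    (woldT : admits_wold_decomposition T) :
  (exists! HA : {set 'I_n} -> set H, wold_decomposition T HA) /\
  (forall HA : {set 'I_n} -> set H, wold_decomposition T HA ->
     forall A : {set 'I_n},
       HA A = (\bigcap_(i in [set i | i \notin A]) invertible_part (T i)) `&`
              (\bigcap_(k in [set k | k \in A]) shift_part (T k))).
Proof.
split=> [|HA wHA A]; last exact: wold_decompositionE.
have [HA wHA] := woldT; exists HA; split=> // HA' wHA'.
(* The formula for [HA A] does not mention the decomposition, so any two agree. *)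
by apply/funext => A; rewrite !(wold_decompositionE _ nearT).
Qed.
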